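(* Let $G$ be a group acting by isometries on a $\delta$-hyperbolic geodesic metric space $X$ with $\delta\ge1$, and let $\mathcal{C}=(C,\{G_c\mid c\in C\})$ be a $\rho$-separated fairly rotating family with $\rho\ge 2\delta\log_2(\delta)+38\delta$. Then the normal closure in $G$ of $\bigcup_{c\in C}G_c$ is isomorphic to a free product $\ast_{c\in C'}G_c$ for some subset $C'\subseteq C$.
   Context: A geodesic metric space is $\delta$-hyperbolic if every geodesic triangle is $\delta$-thin (points of the triangle with the same image in the comparison tripod are at distance $\le\delta$). A rotating family $\mathcal{C}=(C,\{G_c\})$ consists of a $G$-invariant subset $C\subseteq X$ and subgroups $G_c\le G$ with $G_c$ fixing $c$ and $G_{gc}=gG_cg^{-1}$ for all $g\in G$, $c\in C$. It is $\rho$-separated if distinct points of $C$ are at distance $\ge\rho$. It is fairly rotating if for all $c\in C$, $g\in G_c\setminus\{1\}$ and $x\in C\setminus\{c\}$, some geodesic from $x$ to $gx$ meets the closed ball of radius $1$ about $c$. *)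

(* Defs.v *)
From Stdlib Require Import Reals List.
Open Scope R_scope.
Import ListNotations.

Record MetricSpace := {
  pt :> Type;
  dist : pt -> pt -> R;
  dist_eq0 : forall x y, dist x y = 0 <-> x = y;
  dist_sym : forall x y, dist x y = dist y x;
  dist_tri : forall x y z, dist x z <= dist x y + dist y z
}.
Arguments dist {m} _ _.

(** A geodesic from x to y: an isometric map of [0, d(x,y)] (extended
    arbitrarily to R) with endpoints x and y. *)
Definition geodesic {X : MetricSpace} (x y : X) (g : R -> X) : Prop :=
  g 0 = x /\ g (dist x y) = y /\
  forall s t, 0 <= s <= dist x y -> 0 <= t <= dist x y ->
    dist (g s) (g t) = Rabs (s - t).

Definition geodesic_space (X : MetricSpace) : Prop :=
  forall x y : X, exists g, geodesic x y g.

Definition gromov {X : MetricSpace} (x y z : X) : R :=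
  (dist x y + dist x z - dist y z) / 2.

(** The geodesic triangle with sides g1 : [x,y], g2 : [y,z], g3 : [z,x] is
    delta-thin: any two points of the triangle with the same image in the
    comparison tripod are at distance <= delta.  Two points have the same
    image in the tripod iff they are equal, or they lie on the two sides
    issuing from a common vertex v, at the same distance t from v, with
    t <= the Gromov product at v. *)
Definition thin_triangle {X : MetricSpace} (delta : R) (x y z : X)
  (g1 g2 g3 : R -> X) : Prop :=
  (forall t, 0 <= t <= gromov x y z ->
     dist (g1 t) (g3 (dist z x - t)) <= delta) /\
  (forall t, 0 <= t <= gromov y z x ->
     dist (g2 t) (g1 (dist x y - t)) <= delta) /\
  (forall t, 0 <= t <= gromov z x y ->
     dist (g3 t) (g2 (dist y z - t)) <= delta).

Definition hyperbolic (X : MetricSpace) (delta : R) : Prop :=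
  geodesic_space X /\
  forall (x y z : X) g1 g2 g3,
    geodesic x y g1 -> geodesic y z g2 -> geodesic z x g3 ->
    thin_triangle delta x y z g1 g2 g3.

Record Group := {
  gcar :> Type;
  gmul : gcar -> gcar -> gcar;
  gone : gcar;
  ginv : gcar -> gcar;
  gmulA : forall a b c, gmul a (gmul b c) = gmul (gmul a b) c;
  gmul1l : forall a, gmul gone a = a;
  gmul1r : forall a, gmul a gone = a;
  gmulVl : forall a, gmul (ginv a) a = gone;
  gmulVr : forall a, gmul a (ginv a) = gone
}.
Arguments gmul {g} _ _.
Arguments gone {g}.
Arguments ginv {g} _.

Definition subgroup {G : Group} (H : G -> Prop) : Prop :=
  H gone /\ (forall a b, H a -> H b -> H (gmul a b)) /\
  (forall a, H a -> H (ginv a)).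

Definition normal_subgroup {G : Group} (H : G -> Prop) : Prop :=
  subgroup H /\ forall g h, H h -> H (gmul g (gmul h (ginv g))).

Definition normal_closure {G : Group} (S : G -> Prop) : G -> Prop :=
  fun g => forall H : G -> Prop, normal_subgroup H ->
    (forall s, S s -> H s) -> H g.

Fixpoint list_prod {G : Group} (l : list G) : G :=
  match l with
  | [] => gone
  | a :: l' => gmul a (list_prod l')
  end.

Fixpoint alternating {I : Type} (l : list I) : Prop :=
  match l with
  | a :: ((b :: _) as l') => a <> b /\ alternating l'
  | _ => True
  end.

(** N is the (internal) free product of the family of subgroups (H i)_{i in I}:
    the H i (i in I) are subgroups contained in N that generate N, and every
    nonempty reduced word (nontrivial letters, consecutive letters from
    distinct factors) has nontrivial product.  Equivalently, the natural map
    from the free product *_{i in I} H i to G is injective with image N. *)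
Definition free_product_of {G : Group} {Idx : Type} (N : G -> Prop)
  (I : Idx -> Prop) (H : Idx -> G -> Prop) : Prop :=
  (forall i, I i -> subgroup (H i) /\ forall h, H i h -> N h) /\
  (forall n, N n -> exists w : list (Idx * G),
      Forall (fun p => I (fst p) /\ H (fst p) (snd p)) w /\
      n = list_prod (map snd w)) /\
  (forall w : list (Idx * G), w <> [] ->
      Forall (fun p => I (fst p) /\ H (fst p) (snd p) /\ snd p <> gone) w ->
      alternating (map fst w) ->
      list_prod (map snd w) <> gone).

Definition isometric_action (G : Group) (X : MetricSpace) (act : G -> X -> X)
  : Prop :=
  (forall x, act gone x = x) /\
  (forall g h x, act (gmul g h) x = act g (act h x)) /\
  (forall g x y, dist (act g x) (act g y) = dist x y).

Definition rotating_family {G : Group} {X : MetricSpace} (act : G -> X -> X)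
  (C : X -> Prop) (Gc : X -> G -> Prop) : Prop :=
  (forall g c, C c -> C (act g c)) /\
  (forall c, C c -> subgroup (Gc c)) /\
  (forall c g, C c -> Gc c g -> act g c = c) /\
  (forall g c h, C c ->
     (Gc (act g c) h <-> exists k, Gc c k /\ h = gmul g (gmul k (ginv g)))).

Definition separated {X : MetricSpace} (rho : R) (C : X -> Prop) : Prop :=
  forall x y, C x -> C y -> x <> y -> rho <= dist x y.

Definition fairly_rotating {G : Group} {X : MetricSpace} (act : G -> X -> X)
  (C : X -> Prop) (Gc : X -> G -> Prop) : Prop :=
  forall c g x, C c -> Gc c g -> g <> gone -> C x -> x <> c ->
    exists gam, geodesic x (act g x) gam /\
      exists t, 0 <= t <= dist x (act g x) /\ dist (gam t) c <= 1.

Definition log2 (x : R) : R := ln x / ln 2.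

(* Main.v *)
(** Thin triangles give the four-point inequality for Gromov products, and a
    fair rotation [g] about [c] satisfies [(x | g x)_c <= 1] on [C].

    Enlarge a set [T] of centers by Zorn's lemma, keeping the following: the
    rotation groups of [T] generate their free product [H]; [H] acts freely
    on the centers outside [S = H T]; and such a center is [5 delta]-far from
    the hull of [S], i.e. [(x | y)_c >= 5 delta] for [x], [y] in [S].  If
    [S <> C], let [M] be the set of centers outside [S] whose distance to the
    hull of [S] is within [4 delta] of the infimum, and add to [T] one
    representative of each [H]-orbit in [M].  Elements of the enlarged group
    are [a_1 ... a_n h] with [h] in [H] and nontrivial rotations [a_i] about
    points [m_i] of [M], [m_i <> m_(i+1)].  Seen from [m] in [M], all other
    points of [S] and [M] lie in the direction of [S], and rotating about [m]
    moves that direction away; so the polygon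
    [x, m_1, a_1 m_2, a_1 a_2 m_3, ...] has sides of length at least
    [rho >= 38 delta] and Gromov products at most [3 delta] at its corners.
    It is therefore a quasi-geodesic, which gives freeness, and a center
    outside is as far from the polygon as it is from one of its sides, which
    gives the [5 delta] bound again. *)

From Stdlib Require Import Reals List Lra Lia Classical ClassicalEpsilon.
From Stdlib Require Import FunctionalExtensionality PropExtensionality.
From mathcomp Require classical_sets.
Require Import Defs.
Import ListNotations.
Open Scope R_scope.

(** * Groups and alternating lists *)

Section Groups.
Context {G : Group}.
Implicit Types a b : G.

Lemma mulKg a b : gmul (ginv a) (gmul a b) = b.
Proof. now rewrite gmulA, gmulVl, gmul1l. Qed.

Lemma mulKVg a b : gmul a (gmul (ginv a) b) = b.
Proof. now rewrite gmulA, gmulVr, gmul1l. Qed.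

Lemma invg_unique a b : gmul a b = gone -> ginv a = b.
Proof. intros E. now rewrite <- (mulKg a b), E, gmul1r. Qed.

Lemma invgK a : ginv (ginv a) = a.
Proof. apply invg_unique, gmulVl. Qed.

Lemma invMg a b : ginv (gmul a b) = gmul (ginv b) (ginv a).
Proof. apply invg_unique. now rewrite <- gmulA, mulKVg, gmulVr. Qed.

Lemma invg1 : ginv (gone : G) = gone.
Proof. apply invg_unique, gmul1l. Qed.

Lemma list_prod_app (l1 l2 : list G) :
  list_prod (l1 ++ l2) = gmul (list_prod l1) (list_prod l2).
Proof.
induction l1 as [|a l1 IH]; simpl; [now rewrite gmul1l|].
now rewrite IH, gmulA.
Qed.

Lemma conj_neq1 a b : b <> gone -> gmul a (gmul b (ginv a)) <> gone.
Proof.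
intros nb E. apply nb.
rewrite <- (mulKg a b), <- (gmul1r _ (gmul a b)), <- (gmulVl _ a).
now rewrite (gmulA _ (gmul a b)), <- (gmulA _ a), E, gmul1l, gmulVl.
Qed.
End Groups.

Ltac gsimp :=
  repeat first [ rewrite <- gmulA | rewrite gmul1l | rewrite gmul1r
    | rewrite gmulVl | rewrite gmulVr | rewrite mulKg | rewrite mulKVg
    | rewrite invMg | rewrite invgK | rewrite invg1 ].

Section Alternating.
Context {I : Type}.
Implicit Types (l : list I) (x y : I).

Lemma alternating_tail x l : alternating (x :: l) -> alternating l.
Proof. destruct l; simpl; tauto. Qed.

Lemma alternating_app_l l1 l2 : alternating (l1 ++ l2) -> alternating l1.
Proof.
induction l1 as [|x [|y l1] IH]; simpl; try easy.
intros [n A]; split; [easy|]. exact (IH A).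
Qed.

Lemma alternating_glue l1 l2 x :
  alternating (l1 ++ [x]) -> alternating (x :: l2) ->
  alternating (l1 ++ x :: l2).
Proof.
induction l1 as [|y [|z l1] IH]; [easy|simpl; tauto|].
intros [n A] B; split; [easy|]. exact (IH A B).
Qed.

Lemma alternating_rcons l x :
  alternating l -> (forall y, In y l -> y <> x) -> alternating (l ++ [x]).
Proof.
induction l as [|y [|z l] IH]; [easy|simpl; auto|].
intros [n A] B; split; [easy|].
apply (IH A). intros t Ht; apply B; now right.
Qed.

Lemma alternating_map {J : Type} (f : I -> J) l :
  (forall x y, In x l -> In y l -> f x = f y -> x = y) ->
  alternating l -> alternating (map f l).
Proof.
induction l as [|x [|y l] IH]; [easy|easy|].
intros inj [n A]; split.
- intros E; apply n, inj; simpl; auto.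
- apply IH; [|easy]. intros; apply inj; simpl in *; auto.
Qed.
End Alternating.

(** * The four-point inequality *)

Section FourPoint.
Context {X : MetricSpace}.
Implicit Types w x y z : X.

Lemma dist_xx x : dist x x = 0.
Proof. now apply dist_eq0. Qed.

Lemma gromov_sym w x y : gromov w x y = gromov w y x.
Proof. unfold gromov. rewrite (dist_sym _ y x). lra. Qed.

Lemma gromov_ge0 w x y : 0 <= gromov w x y.
Proof.
unfold gromov. pose proof (dist_tri _ x w y).
rewrite (dist_sym _ x w) in H. lra.
Qed.

Lemma gromov_le_dist w x y : gromov w x y <= dist w x.
Proof.
unfold gromov. pose proof (dist_tri _ w x y). lra.
Qed.

Lemma gromov_flip w x y : gromov w x y = dist w x - gromov x w y.
Proof. unfold gromov. rewrite (dist_sym _ x w). lra. Qed.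

Lemma gromov_xx w x : gromov w x x = dist w x.
Proof. unfold gromov. rewrite dist_xx. lra. Qed.

Lemma gromov_base w y : gromov w w y = 0.
Proof. unfold gromov. rewrite dist_xx. lra. Qed.

(** This is [(x | z)_w >= min((x | y)_w, (y | z)_w) - delta]. The disjunction replaces the minimum
    so that a case split leaves linear arithmetic. *)
Definition four_point (X : MetricSpace) (delta : R) : Prop :=
  forall w x y z : X,
    gromov w x y - delta <= gromov w x z \/
    gromov w y z - delta <= gromov w x z.

(** With [t] the smaller product, the points at distance [t] from [w] on [[w, x]] and on [[w, z]]
    are both [delta]-close to one point of the shared side [[y, w]], so [d(x, z) <= d(w, x) + d(w,
    z) - 2 t + 2 delta]. *)
Lemma hyperbolic_four_point delta : hyperbolic X delta -> four_point X delta.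
Proof.
intros [geo thin] w x y z.
destruct (geo w x) as [g1 G1], (geo x y) as [g2 G2], (geo y w) as [g3 G3].
destruct (geo w z) as [h1 H1], (geo z y) as [h2 H2].
pose proof (thin _ _ _ _ _ _ G1 G2 G3) as [T1 _].
pose proof (thin _ _ _ _ _ _ H1 H2 G3) as [T2 _].
set (t := Rmin (gromov w x y) (gromov w y z)).
assert (t1 : t <= gromov w x y) by apply Rmin_l.
assert (t2 : t <= gromov w y z) by apply Rmin_r.
assert (t0 : 0 <= t) by (apply Rmin_glb; apply gromov_ge0).
assert (key : t - delta <= gromov w x z).
{ specialize (T1 t (conj t0 t1)).
  rewrite gromov_sym in t2. specialize (T2 t (conj t0 t2)).
  pose proof (gromov_le_dist w x y). pose proof (gromov_le_dist w z y).
  destruct G1 as (_ & E1 & I1), H1 as (_ & E2 & I2).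
  pose proof (I1 t (dist w x) ltac:(lra) ltac:(lra)) as J1.
  pose proof (I2 t (dist w z) ltac:(lra) ltac:(lra)) as J2.
  rewrite E1 in J1. rewrite E2 in J2.
  rewrite Rabs_left1 in J1, J2 by lra.
  set (p := g3 (dist y w - t)) in *.
  pose proof (dist_tri _ x (g1 t) z). pose proof (dist_tri _ (g1 t) p z).
  pose proof (dist_tri _ p (h1 t) z).
  rewrite (dist_sym _ x (g1 t)) in *. rewrite (dist_sym _ p (h1 t)) in *.
  unfold gromov. lra. }
unfold t, Rmin in key. destruct (Rle_dec _ _); [left|right]; lra.
Qed.
End FourPoint.

(** * Rotating families *)

(** Completeness is applied to the negated set. This supplies the [mu] of [good_enlarge]. *)
Lemma near_infimum (E : R -> Prop) (b e : R) :
  (exists r, E r) -> (forall r, E r -> b <= r) -> 0 < e ->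
  exists mu, b <= mu /\ (forall r, E r -> mu <= r) /\
    exists r, E r /\ r <= mu + e.
Proof.
intros [r0 E0] low pos.
destruct (completeness (fun r => E (- r))) as [l [ub lub]].
- exists (- b). intros r Er. specialize (low _ Er). lra.
- exists (- r0). now rewrite Ropp_involutive.
- exists (- l). split; [|split].
  + enough (l <= - b) by lra. apply lub. intros r Er. specialize (low _ Er). lra.
  + intros r Er. enough (- r <= l) by lra. apply ub. now rewrite Ropp_involutive.
  + apply NNPP; intros no. enough (l <= l - e) by lra.
    apply lub. intros r Er. apply Rnot_lt_le; intros lt.
    apply no. exists (- r). split; [easy|lra].
Qed.

Section RotatingFamily.
Context {G : Group} {X : MetricSpace} {act : G -> X -> X}.
Context {delta rho : R} {C : X -> Prop} {Gc : X -> G -> Prop}.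
Context (act_iso : isometric_action G X act).
Context (rot : rotating_family act C Gc).
Context (fair : fairly_rotating act C Gc).
Context (sep : separated rho C).
Context (hyp : four_point X delta) (delta_ge1 : 1 <= delta).
Context (rho_ge : 38 * delta <= rho).

Lemma act1 x : act gone x = x.
Proof. apply act_iso. Qed.

Lemma actM g h x : act (gmul g h) x = act g (act h x).
Proof. apply act_iso. Qed.

Lemma actK g x : act (ginv g) (act g x) = x.
Proof. now rewrite <- actM, gmulVl, act1. Qed.

Lemma actVK g x : act g (act (ginv g) x) = x.
Proof. now rewrite <- actM, gmulVr, act1. Qed.

Lemma act_inj g x y : act g x = act g y -> x = y.
Proof. intros E. now rewrite <- (actK g x), E, actK. Qed.

Lemma dist_act g x y : dist (act g x) (act g y) = dist x y.
Proof. apply act_iso. Qed.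

Lemma gromov_act g w x y :
  gromov (act g w) (act g x) (act g y) = gromov w x y.
Proof. unfold gromov. now rewrite !dist_act. Qed.

Lemma gromov_actV g w x y :
  gromov w x (act g y) = gromov (act (ginv g) w) (act (ginv g) x) y.
Proof. now rewrite <- (gromov_act g (act (ginv g) w)), !actVK. Qed.

Lemma C_act g c : C c -> C (act g c).
Proof. apply rot. Qed.

Lemma Gc_one c : C c -> Gc c gone.
Proof. intros Cc. now apply rot. Qed.

Lemma Gc_mul c a b : C c -> Gc c a -> Gc c b -> Gc c (gmul a b).
Proof.
intros Cc. destruct rot as (_ & sub & _). destruct (sub c Cc) as (_ & m & _).
apply m.
Qed.

Lemma Gc_inv c a : C c -> Gc c a -> Gc c (ginv a).
Proof.
intros Cc. destruct rot as (_ & sub & _). destruct (sub c Cc) as (_ & _ & i).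
apply i.
Qed.

Lemma Gc_fix c a : C c -> Gc c a -> act a c = c.
Proof. destruct rot as (_ & _ & f & _). apply f. Qed.

Lemma Gc_fixV c a : C c -> Gc c a -> act (ginv a) c = c.
Proof. intros Cc Ga. apply Gc_fix; [easy|]. now apply Gc_inv. Qed.

Lemma Gc_conj g c a : C c -> Gc c a -> Gc (act g c) (gmul g (gmul a (ginv g))).
Proof. intros Cc Ga. destruct rot as (_ & _ & _ & conj). apply conj; eauto. Qed.

Lemma sep_delta x y : C x -> C y -> x <> y -> 38 * delta <= dist x y.
Proof. intros Cx Cy n. pose proof (sep x y Cx Cy n). lra. Qed.

(** A point of the geodesic within 1 of [c] gives [d(c, x) + d(c, g x) <= d(x, g x) + 2]. *)
Lemma fair_gromov c g x :
  C c -> Gc c g -> g <> gone -> C x -> x <> c -> gromov c x (act g x) <= 1.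
Proof.
intros Cc Gg ng Cx nx.
destruct (fair c g x Cc Gg ng Cx nx) as (gam & (E0 & E1 & iso) & t & Ht & near).
pose proof (iso 0 t ltac:(lra) Ht) as D0.
pose proof (iso t (dist x (act g x)) Ht ltac:(lra)) as D1.
rewrite E0 in D0. rewrite E1 in D1.
rewrite Rabs_left1 in D0, D1 by lra.
pose proof (dist_tri _ c (gam t) x). pose proof (dist_tri _ c (gam t) (act g x)).
rewrite (dist_sym _ (gam t) x) in *. rewrite (dist_sym _ c (gam t)) in *.
unfold gromov. lra.
Qed.

Lemma fair_free c g x :
  C c -> Gc c g -> g <> gone -> C x -> x <> c -> act g x <> x.
Proof.
intros Cc Gg ng Cx nx E.
pose proof (fair_gromov c g x Cc Gg ng Cx nx) as F.
rewrite E, gromov_xx in F.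
pose proof (sep_delta c x Cc Cx (not_eq_sym nx)). lra.
Qed.

(** * Words of rotations and the groups they generate *)

Definition wprod (w : list (X * G)) : G := list_prod (map snd w).

Lemma wprod_app w1 w2 : wprod (w1 ++ w2) = gmul (wprod w1) (wprod w2).
Proof. unfold wprod. now rewrite map_app, list_prod_app. Qed.

Definition nontriv_word (M : X -> Prop) (w : list (X * G)) : Prop :=
  Forall (fun p => M (fst p) /\ Gc (fst p) (snd p) /\ snd p <> gone) w.

(** By [Gc_conj] the new letters are rotations about the translated centers. This moves [h] past a
    word: [h w = (conj_word h w) h]. *)
Definition conj_word (h : G) (w : list (X * G)) : list (X * G) :=
  map (fun p => (act h (fst p), gmul h (gmul (snd p) (ginv h)))) w.

Lemma wprod_conj h w :
  wprod (conj_word h w) = gmul h (gmul (wprod w) (ginv h)).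
Proof.
unfold wprod. induction w as [|[m a] w IH]; simpl.
- now rewrite gmul1l, gmulVr.
- rewrite IH. now gsimp.
Qed.

Lemma map_fst_conj h w : map fst (conj_word h w) = map (act h) (map fst w).
Proof. unfold conj_word. now rewrite !map_map. Qed.

Lemma alternating_conj h w :
  alternating (map fst w) -> alternating (map fst (conj_word h w)).
Proof.
intros A. rewrite map_fst_conj. apply alternating_map; [|easy].
intros x y _ _; apply act_inj.
Qed.

(** Products of letters already form a group, since each [Gc t] contains its inverses. *)
Inductive gen (T : X -> Prop) : G -> Prop :=
| gen_one : gen T gone
| gen_cons t g h : T t -> Gc t g -> gen T h -> gen T (gmul g h).

Definition orbit (T : X -> Prop) (x : X) : Prop :=
  exists h t, gen T h /\ T t /\ x = act h t.

Lemma gen_letter (T : X -> Prop) t g : T t -> Gc t g -> gen T g.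
Proof.
intros Tt Gg. rewrite <- (gmul1r _ g).
apply (gen_cons T t); [easy..|]. apply gen_one.
Qed.

Lemma gen_mul (T : X -> Prop) g h : gen T g -> gen T h -> gen T (gmul g h).
Proof.
intros Tg Th. induction Tg as [|t a g Tt Ga _ IH]; [now rewrite gmul1l|].
rewrite <- gmulA. now apply (gen_cons T t).
Qed.

Lemma gen_inv (T : X -> Prop) g :
  (forall x, T x -> C x) -> gen T g -> gen T (ginv g).
Proof.
intros TC Tg. induction Tg as [|t a g Tt Ga _ IH].
- rewrite invg1. apply gen_one.
- rewrite invMg. apply gen_mul; [easy|].
  apply (gen_letter T t); [easy|]. apply Gc_inv; auto.
Qed.

Lemma gen_subgroup (T : X -> Prop) : (forall x, T x -> C x) -> subgroup (gen T).
Proof.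
intros TC. split; [apply gen_one|split].
- apply gen_mul.
- intros a. now apply gen_inv.
Qed.

Lemma gen_mono (T T' : X -> Prop) g :
  (forall x, T x -> T' x) -> gen T g -> gen T' g.
Proof.
intros TT Tg. induction Tg as [|t a g Tt Ga _ IH]; [apply gen_one|].
apply (gen_cons T' t); auto.
Qed.

Lemma gen_word (T : X -> Prop) g : gen T g ->
  exists w : list (X * G),
    Forall (fun p => T (fst p) /\ Gc (fst p) (snd p)) w /\ g = wprod w.
Proof.
intros Tg. induction Tg as [|t a g Tt Ga _ (w & Fw & E)].
- now exists [].
- exists ((t, a) :: w). split; [now constructor|]. unfold wprod in *; simpl.
  now rewrite E.
Qed.

Lemma word_gen (T : X -> Prop) w :
  Forall (fun p => T (fst p) /\ Gc (fst p) (snd p)) w -> gen T (wprod w).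
Proof.
intros Fw. induction Fw as [|[t a] w [Tt Ga] _ IH]; [apply gen_one|].
now apply (gen_cons T t).
Qed.

Lemma orbit_self (T : X -> Prop) t : T t -> orbit T t.
Proof. intros Tt. exists gone, t. rewrite act1. now split; [apply gen_one|]. Qed.

Lemma orbit_act (T : X -> Prop) h x : gen T h -> orbit T x -> orbit T (act h x).
Proof.
intros Th (g & t & Tg & Tt & ->). exists (gmul h g), t.
rewrite actM. split; [now apply gen_mul|easy].
Qed.

Lemma orbit_actV (T : X -> Prop) h x :
  (forall t, T t -> C t) -> gen T h -> orbit T (act h x) -> orbit T x.
Proof.
intros TC Th O. rewrite <- (actK h x). apply orbit_act; [|easy].
now apply gen_inv.
Qed.

Lemma orbit_C (T : X -> Prop) x : (forall t, T t -> C t) -> orbit T x -> C x.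
Proof. intros TC (h & t & _ & Tt & ->). apply C_act. auto. Qed.

Lemma orbit_mono (T T' : X -> Prop) x :
  (forall t, T t -> T' t) -> orbit T x -> orbit T' x.
Proof.
intros TT (h & t & Th & Tt & ->). exists h, t. split; [|auto].
now apply (gen_mono T).
Qed.

(** The group at [h t] is the conjugate of [Gc t] by [h], and [h] lies in [gen T]. *)
Lemma orbit_Gc_gen (T : X -> Prop) x g :
  (forall t, T t -> C t) -> orbit T x -> Gc x g -> gen T g.
Proof.
intros TC (h & t & Th & Tt & ->) Gg.
apply rot in Gg; [|now apply TC]. destruct Gg as (k & Gk & ->).
apply gen_mul; [easy|]. apply gen_mul; [now apply (gen_letter T t)|].
now apply gen_inv.
Qed.

Definition good (T : X -> Prop) : Prop :=
  (forall t, T t -> C t) /\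
  (forall w, w <> [] -> nontriv_word T w -> alternating (map fst w) ->
     wprod w <> gone) /\
  (forall c h, C c -> ~ orbit T c -> gen T h -> h <> gone -> act h c <> c) /\
  (forall c x y, C c -> ~ orbit T c -> orbit T x -> orbit T y ->
     5 * delta <= gromov c x y).

(** * Enlarging a good set *)

Section Windmill.
Context {T : X -> Prop} {mu : R} (T_good : good T).
Local Notation H := (gen T).
Local Notation S := (orbit T).
Context (S_ne : exists s, S s).
Context (mu_ge : 5 * delta <= mu).
Context (mu_le : forall c x y, C c -> ~ S c -> S x -> S y -> mu <= gromov c x y).

(* The set [M] of the overview; [gromov c x y] is the distance from [c] to
   the geodesic [x, y], up to an error of order [delta]. *)
Definition sail (c : X) : Prop :=
  C c /\ ~ S c /\ exists x y, S x /\ S y /\ gromov c x y <= mu + 4 * delta.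

Definition hub (c : X) : Prop := S c \/ sail c.

Lemma T_C t : T t -> C t.
Proof. apply T_good. Qed.

Lemma S_C x : S x -> C x.
Proof. apply orbit_C, T_C. Qed.

Lemma H_free c h : C c -> ~ S c -> H h -> h <> gone -> act h c <> c.
Proof. apply T_good. Qed.

Lemma sail_C m : sail m -> C m.
Proof. now intros [? _]. Qed.

Lemma hub_C x : hub x -> C x.
Proof. intros [Sx|Mx]; [now apply S_C | now apply sail_C]. Qed.

Lemma sail_act h m : H h -> sail m -> sail (act h m).
Proof.
intros Hh (Cm & nS & x & y & Sx & Sy & le). split; [now apply C_act|split].
- intros Sm. now apply nS, (orbit_actV T h); [apply T_C| |].
- exists (act h x), (act h y). rewrite gromov_act. auto using orbit_act.
Qed.

Lemma hub_act h x : H h -> hub x -> hub (act h x).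
Proof.
intros Hh [Sx|Mx]; [left; now apply orbit_act | right; now apply sail_act].
Qed.

Lemma S_neq_sail x m : S x -> sail m -> x <> m.
Proof. intros Sx (_ & nS & _) E. subst. tauto. Qed.

(* Otherwise every geodesic from m' to S runs through m, and m' would be about
   rho farther than m from the hull of S. *)
Lemma sail_toward_S m m' x :
  sail m -> sail m' -> m' <> m -> S x -> 4 * delta <= gromov m m' x.
Proof.
intros (Cm & nSm & _) (Cm' & nSm' & y & z & Sy & Sz & le) n Sx.
apply Rnot_lt_le; intros lt.
assert (K : forall s, S s -> gromov m m' s < 5 * delta).
{ intros s Ss. pose proof (mu_le m s x Cm nSm Ss Sx).
  destruct (hyp m m' s x); lra. }
pose proof (K y Sy) as Ky. pose proof (K z Sz) as Kz.
pose proof (mu_le m y z Cm nSm Sy Sz) as L.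
pose proof (sep_delta m m' Cm Cm' (not_eq_sym n)).
(* Here [(y | z)_m' = d(m, m') + (y | z)_m - (m' | y)_m - (m' | z)_m > mu + 28 delta], which
   contradicts [le]. *)
unfold gromov in *. rewrite (dist_sym _ m m') in *. lra.
Qed.

Lemma hub_toward_S m x s :
  sail m -> hub x -> x <> m -> S s -> 4 * delta <= gromov m x s.
Proof.
intros Mm [Sx|Mx] n Ss; [|now apply sail_toward_S].
destruct Mm as (Cm & nS & _). pose proof (mu_le m x s Cm nS Sx Ss). lra.
Qed.

(* [x] and [y] lie in the direction of [S], which [a] turns by a definite
   angle. *)
Lemma turn m a x y :
  sail m -> Gc m a -> a <> gone -> hub x -> hub y -> x <> m -> y <> m ->
  gromov m x (act a y) <= 3 * delta.
Proof.
intros Mm Ga na Bx By nx ny. destruct S_ne as [s Ss].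
pose proof (sail_C m Mm) as Cm.
pose proof (fair_gromov m a s Cm Ga na (S_C s Ss) (S_neq_sail s m Ss Mm)) as F.
pose proof (hub_toward_S m x s Mm Bx nx Ss) as Fx.
pose proof (hub_toward_S m y s Mm By ny Ss) as Fy.
rewrite <- (gromov_act a), (Gc_fix m a Cm Ga) in Fy.
rewrite (gromov_sym m x s) in Fx.
(* As [(s | a s)_m <= 1], the first use gives [(x | a s)_m <= 2 delta]; as
   [(a y | a s)_m >= 4 delta], the second gives the claim. *)
destruct (hyp m s x (act a s)) as [|K]; [lra|].
destruct (hyp m x (act a y) (act a s)); lra.
Qed.

(** * Polygons traced by reduced words *)

Lemma nontriv_word_conj h w :
  H h -> nontriv_word sail w -> nontriv_word sail (conj_word h w).
Proof.
intros Hh Rw. unfold nontriv_word in *. rewrite Forall_forall in Rw.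
apply Forall_forall. intros p Hp.
apply in_map_iff in Hp. destruct Hp as ([m a] & <- & Hin).
destruct (Rw _ Hin) as (Mp & Gp & np); simpl in *.
split; [now apply sail_act|split].
- apply Gc_conj; [now apply sail_C|easy].
- now apply conj_neq1.
Qed.

(** On the polygon [x, m_1, a_1 m_2, ...] that ends at [wprod w y], this is the vertex following
    [x]. *)
Definition next (w : list (X * G)) (y : X) : X :=
  match w with [] => y | p :: _ => fst p end.

Lemma next_hub w y : nontriv_word sail w -> hub y -> hub (next w y).
Proof. intros [|p w' [Mp _] _] By; [easy | now right]. Qed.

Lemma next_neq x w y :
  alternating (x :: map fst w ++ [y]) -> next w y <> x.
Proof. destruct w; simpl; intros [n _]; auto. Qed.

(** The bound does not deteriorate along the word. Induction at the next center [m2] and the length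
    of [[m, m2]] put the endpoint within the direction of [a m2], with product at least [34 delta]
    at [m]; [turn] bounds the angle there by [3 delta], and a single four-point step costs one
    [delta]. *)
Lemma chain w : forall m a x y,
  nontriv_word sail ((m, a) :: w) -> hub x -> hub y -> x <> m ->
  alternating (m :: map fst w ++ [y]) ->
  gromov m x (act (wprod ((m, a) :: w)) y) <= 4 * delta.
Proof.
induction w as [|[m2 a2] w IH]; intros m a x y Rw Bx By nx A;
  inversion_clear Rw as [|? ? (Mm & Ga & na) Rw']; simpl in Mm, Ga, na;
  unfold wprod; simpl; rewrite actM.
- rewrite act1. destruct A as [ny _].
  pose proof (turn m a x y Mm Ga na Bx By nx (not_eq_sym ny)). lra.
- destruct A as [n2 A]. fold (wprod w).
  inversion Rw' as [|? ? (M2 & _ & _) _]; simpl in M2.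
  pose proof (IH m2 a2 m y Rw' (or_intror Mm) By n2 A) as I.
  unfold wprod in I; simpl in I; fold (wprod w) in I.
  set (q := act (gmul a2 (wprod w)) y) in *.
  pose proof (turn m a x m2 Mm Ga na Bx (or_intror M2) nx (not_eq_sym n2)) as Tm.
  pose proof (sep_delta m m2 (sail_C m Mm) (sail_C m2 M2) n2).
  assert (J : 34 * delta <= gromov m (act a m2) (act a q)).
  { rewrite <- (Gc_fix m a (sail_C m Mm) Ga) at 1.
    rewrite gromov_act, gromov_flip. lra. }
  rewrite gromov_sym in J.
  destruct (hyp m x (act a q) (act a m2)); lra.
Qed.

Lemma nontriv_word_cons m a w :
  nontriv_word sail ((m, a) :: w) ->
  sail m /\ Gc m a /\ a <> gone /\ nontriv_word sail w.
Proof.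
intros Rw. inversion_clear Rw as [|? ? (Mm & Ga & na) Rw'].
simpl in *. auto.
Qed.

Lemma act_wprod_cons m a w y :
  act (wprod ((m, a) :: w)) y = act a (act (wprod w) y).
Proof. unfold wprod; simpl. now rewrite actM. Qed.

(** Seen from [x], the endpoint lies in the direction of the first vertex, with product at least
    [34 delta]. Any [e] below [33 delta] therefore survives with a loss of one [delta]. *)
Lemma chain_from p e w x y :
  nontriv_word sail w -> hub x -> hub y -> alternating (x :: map fst w ++ [y]) ->
  gromov x p (next w y) <= e -> e <= 30 * delta ->
  gromov x p (act (wprod w) y) <= e + delta.
Proof.
intros Rw Bx By A le small. destruct w as [|[m a] w]; simpl in le.
- unfold wprod; simpl. rewrite act1. lra.
- destruct A as [n A].
  pose proof (chain w m a x y Rw Bx By n A) as K.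
  destruct (nontriv_word_cons _ _ _ Rw) as (Mm & _).
  pose proof (sep_delta x m (hub_C x Bx) (sail_C m Mm) n).
  set (q := act _ y) in *.
  pose proof (gromov_flip x m q) as F. rewrite gromov_sym in F.
  destruct (hyp x p q m); lra.
Qed.

(** Induction step of walking along the polygon away from [p]: [(x | p)_m >= 34 delta], so [turn] at
    [m] transfers from [x] to [p]. Pulling back by [a] makes [m] the new start. *)
Lemma chain_advance p m a w x y :
  nontriv_word sail ((m, a) :: w) -> hub x -> hub y ->
  alternating (x :: m :: map fst w ++ [y]) ->
  gromov x p m <= 4 * delta ->
  gromov m (act (ginv a) p) (next w y) <= 4 * delta.
Proof.
intros Rw Bx By [n A] le.
destruct (nontriv_word_cons _ _ _ Rw) as (Mm & Ga & na & Rw').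
pose proof (turn m a x (next w y) Mm Ga na Bx (next_hub w y Rw' By) n
  (next_neq m w y A)) as Tm.
pose proof (sep_delta x m (hub_C x Bx) (sail_C m Mm) n).
pose proof (gromov_flip m x p) as F.
rewrite (gromov_sym x m p), (dist_sym _ m x) in F.
rewrite <- (Gc_fixV m a (sail_C m Mm) Ga) at 1.
rewrite <- gromov_actV.
destruct (hyp m x p (act a (next w y))); lra.
Qed.

(** [chain_advance] walks along [w1] up to the vertex of [z], and [chain_from] covers the remaining
    word. *)
Lemma chain_pass w1 : forall z b w2 p x y,
  nontriv_word sail (w1 ++ (z, b) :: w2) -> hub x -> hub y ->
  alternating (x :: map fst (w1 ++ (z, b) :: w2) ++ [y]) ->
  gromov x p (next (w1 ++ (z, b) :: w2) y) <= 4 * delta ->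
  gromov (act (wprod w1) z) p (act (wprod (w1 ++ (z, b) :: w2)) y)
    <= 5 * delta.
Proof.
induction w1 as [|[m a] w1 IH]; intros z b w2 p x y Rw Bx By A le;
  simpl app in *; simpl next in le;
  destruct (nontriv_word_cons _ _ _ Rw) as (Mm & Ga & na & Rw');
  pose proof (chain_advance p _ _ _ x y Rw Bx By A le) as K;
  destruct A as [n A].
- rewrite act_wprod_cons, gromov_actV. unfold wprod at 1; simpl.
  rewrite act1, (Gc_fixV _ _ (sail_C _ Mm) Ga).
  pose proof (chain_from _ _ w2 z y Rw' (or_intror Mm) By A K). lra.
- rewrite !act_wprod_cons, gromov_actV, actK.
  exact (IH z b w2 _ m y Rw' (or_intror Mm) By A K).
Qed.

Lemma chain_end_dist w x y :
  w <> [] -> nontriv_word sail w -> hub x -> hub y ->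
  alternating (x :: map fst w ++ [y]) ->
  34 * delta <= dist x (act (wprod w) y).
Proof.
intros ne Rw Bx By A. destruct w as [|[m a] w]; [easy|].
destruct A as [n A]. pose proof (chain w m a x y Rw Bx By n A) as K.
destruct (nontriv_word_cons _ _ _ Rw) as (Mm & _).
pose proof (sep_delta x m (hub_C x Bx) (sail_C m Mm) n).
set (q := act _ y) in *.
pose proof (gromov_flip x m q) as F. pose proof (gromov_le_dist x q m).
rewrite (gromov_sym x q m) in *. lra.
Qed.

(** Same argument as [sail_toward_S], seen from [c]: otherwise [(m | s)_c < 9 delta] for all [s] in
    [S], and [m] would be too far from the hull of [S] to be a sail. *)
Lemma sail_S_far c m x :
  C c -> ~ S c -> ~ sail c -> sail m -> S x -> 8 * delta <= gromov c m x.
Proof.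
intros Cc nS nM (Cm & nSm & y & z & Sy & Sz & le) Sx.
assert (far : forall s t, S s -> S t -> mu + 4 * delta < gromov c s t).
{ intros s t Ss St. apply Rnot_le_lt; intros l. apply nM.
  split; [easy|split; [easy|]]. now exists s, t. }
apply Rnot_lt_le; intros lt.
assert (K : forall s, S s -> gromov c m s < 9 * delta).
{ intros s Ss. pose proof (far s x Ss Sx). destruct (hyp c m s x); lra. }
pose proof (K y Sy). pose proof (K z Sz). pose proof (far y z Sy Sz).
assert (n : c <> m).
{ intros E; subst c. apply nM. split; [easy|split; [easy|]]. now exists y, z. }
pose proof (sep_delta c m Cc Cm n).
unfold gromov in *. rewrite (dist_sym _ c m) in *. lra.
Qed.

(** Two points of [S] give more than [9 delta], since [c] is no sail; a mixed pair gives [8 delta];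
    two sails are compared through a point of [S], at the cost of one more [delta]. *)
Lemma hub_pair_far c x y :
  C c -> ~ S c -> ~ sail c -> hub x -> hub y -> 7 * delta <= gromov c x y.
Proof.
intros Cc nS nM Bx By.
destruct Bx as [Sx|Mx], By as [Sy|My].
- apply Rnot_lt_le; intros lt. apply nM. split; [easy|split; [easy|]].
  exists x, y. split; [easy|split; [easy|]]. lra.
- rewrite gromov_sym. pose proof (sail_S_far c y x Cc nS nM My Sx). lra.
- pose proof (sail_S_far c x y Cc nS nM Mx Sy). lra.
- destruct S_ne as [s Ss].
  pose proof (sail_S_far c x s Cc nS nM Mx Ss).
  pose proof (sail_S_far c y s Cc nS nM My Ss).
  rewrite (gromov_sym c y s) in *. destruct (hyp c x s y); lra.
Qed.

(** * Centers outside the polygons *)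

Section Outside.
Context {Q : X -> Prop}.
Context (Q_out : forall c, Q c -> C c /\ ~ S c /\ ~ sail c).
Context (Q_act : forall m a c, sail m -> Gc m a -> Q c -> Q (act a c)).

Lemma Q_actV m a c : sail m -> Gc m a -> Q c -> Q (act (ginv a) c).
Proof.
intros Mm Ga. apply (Q_act m); [easy|]. now apply Gc_inv; [apply sail_C|].
Qed.

Lemma hub_Q_far c x : Q c -> hub x -> 38 * delta <= dist c x.
Proof.
intros Qc Bx. destruct (Q_out c Qc) as (Cc & nS & nM).
apply sep_delta; [easy|now apply hub_C|]. intros E; subst. destruct Bx; tauto.
Qed.

(* When the path from [p] passes closest to [c] along its side from [x] to
   [next w y], the point [c] lies behind [x], so what follows is a chain
   that starts at [c] and moves away from it. *)
Lemma chain_far_turning w p c x y :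
  Q c -> nontriv_word sail w -> hub x -> hub y ->
  alternating (x :: map fst w ++ [y]) ->
  gromov x p (next w y) <= 4 * delta -> 6 * delta <= gromov c p x ->
  gromov c p (next w y) < 6 * delta ->
  5 * delta <= gromov c p (act (wprod w) y).
Proof.
intros Qc Rw Bx By A turn_x px pz.
pose proof (hub_Q_far c x Qc Bx). destruct (Q_out c Qc) as (Cc & nS & nM).
pose proof (hub_pair_far c x _ Cc nS nM Bx (next_hub _ _ Rw By)) as xz.
(* The constant is [4 + 7]: the product [(p | z)_x] is at most [4 delta], and [(p | x)_c < 7 delta]
   says that [c] is nearly on [[p, x]]. *)
assert (cz : gromov x c (next w y) <= 11 * delta).
{ set (z := next w y) in *.
  assert (gromov c p x < 7 * delta) by (destruct (hyp c p x z); lra).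
  clear px xz. pose proof (dist_tri _ p c z). unfold gromov in *.
  rewrite (dist_sym _ p c), (dist_sym _ p x), (dist_sym _ c x) in *. lra. }
pose proof (chain_from c _ w x y Rw Bx By A cz ltac:(lra)).
set (q := act _ y) in *.
pose proof (gromov_flip c x q). destruct (hyp c p x q); lra.
Qed.

(** Walk along the polygon as long as the next vertex keeps [(p | z)_c >= 6 delta]. At the first
    failure [chain_far_turning] finishes, so the drop from [6 delta] to [5 delta] occurs only
    once. *)
Lemma chain_far w : forall p c x y,
  Q c -> nontriv_word sail w -> hub x -> hub y ->
  alternating (x :: map fst w ++ [y]) ->
  gromov x p (next w y) <= 4 * delta -> 6 * delta <= gromov c p x ->
  5 * delta <= gromov c p (act (wprod w) y).
Proof.
induction w as [|[m a] w IH]; intros p c x y Qc Rw Bx By A turn_x px;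
match type of turn_x with gromov _ _ ?z <= _ =>
  destruct (Rle_lt_dec (6 * delta) (gromov c p z)) as [pz|pz] end;
try now apply (chain_far_turning _ _ _ x).
- simpl in pz. unfold wprod; simpl. rewrite act1. lra.
- simpl next in *. pose proof (chain_advance p m a w x y Rw Bx By A turn_x) as K.
  destruct (nontriv_word_cons _ _ _ Rw) as (Mm & Ga & na & Rw').
  destruct A as [n A]. rewrite act_wprod_cons, gromov_actV.
  apply (IH _ _ m); try easy.
  + now apply (Q_actV m).
  + now right.
  + rewrite <- (Gc_fixV m a (sail_C m Mm) Ga) at 1. now rewrite gromov_act.
Qed.

(* If u fixes a point q, the points s, u s, u^2 s are equidistant from q, so
   d(s, u^2 s) is at most about d(s, u s); along a cyclically reduced word it
   is about twice as large. *)
Lemma cyclically_reduced_no_fixpoint m a w h q :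
  nontriv_word sail ((m, a) :: w) -> H h ->
  alternating (m :: map fst w ++ [act h m]) ->
  act (gmul (wprod ((m, a) :: w)) h) q <> q.
Proof.
intros Rw Hh A fixq. destruct S_ne as [s Ss].
destruct (nontriv_word_cons _ _ _ Rw) as (Mm & Ga & na & Rw').
assert (Hm : sail (act h m)) by now apply sail_act.
set (W := (m, a) :: w) in *. set (u := gmul (wprod W) h) in *.
assert (Rc : nontriv_word sail (conj_word h W)) by now apply nontriv_word_conj.
assert (Rall : nontriv_word sail (W ++ conj_word h W)) by now apply Forall_app.
assert (inM : forall v x, nontriv_word sail v -> In x (map fst v) -> sail x).
{ intros v x Rv Hx. apply in_map_iff in Hx. destruct Hx as (p & <- & Hin).
  unfold nontriv_word in Rv. rewrite Forall_forall in Rv. now apply (Rv p). }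
assert (Shh : S (act h (act h s))) by auto using orbit_act.
assert (Aall : alternating (s :: map fst (W ++ conj_word h W)
                              ++ [act h (act h s)])).
{ split; [now apply S_neq_sail|]. apply alternating_rcons.
  - rewrite map_app. apply alternating_glue; [exact A|].
    apply (alternating_conj h W). exact (alternating_app_l (m :: map fst w) _ A).
  - intros x Hx E. apply (S_neq_sail _ x Shh); [|easy].
    now apply (inM (W ++ conj_word h W)). }
assert (Bs : hub s) by now left.
assert (u1 : act (wprod W) (act h m) = act u m) by (unfold u; now rewrite actM).
(* The square of [u] is traced by a reduced word: [u u = W (conj_word h W) h h], and [u m] is a
   vertex of its polygon. *)
assert (u2 : act (wprod (W ++ conj_word h W)) (act h (act h s)) = act u (act u s)).
{ rewrite <- !actM, wprod_app, wprod_conj. unfold u. f_equal. now gsimp. }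
pose proof (chain_pass W (act h m) (gmul h (gmul a (ginv h))) (conj_word h w)
  s s (act h (act h s)) Rall Bs (or_introl Shh) Aall) as P.
rewrite gromov_base in P. specialize (P ltac:(lra)).
change ((act h m, _) :: conj_word h w) with (conj_word h W) in P.
rewrite u1, u2 in P.
pose proof (chain w m a s (act h m) Rw Bs (or_intror Hm)
  (S_neq_sail s m Ss Mm) A) as K.
fold W in K. rewrite u1 in K.
assert (L : 34 * delta <= dist m (act u m)).
{ unfold u. rewrite actM. unfold W. rewrite act_wprod_cons.
  rewrite <- (Gc_fix m a (sail_C m Mm) Ga) at 1. rewrite dist_act.
  destruct w as [|p w].
  - unfold wprod; simpl. rewrite act1. destruct A as [n _].
    pose proof (sep_delta _ _ (sail_C m Mm) (sail_C _ Hm) n). lra.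
  - apply chain_end_dist; try easy; now right. }
pose proof (dist_act u m (act u s)) as E1.
pose proof (dist_act u s (act u s)) as E2.
pose proof (dist_act u q s) as E3. pose proof (dist_act u q (act u s)) as E4.
rewrite fixq in E3, E4.
pose proof (dist_tri _ s m (act u s)).
set (us := act u s) in *. set (uus := act u us) in *. set (um := act u m) in *.
(* Going through [m] and [u m] gives [d(s, u u s) >= d(s, m) + 34 delta + d(m, u s) - 18 delta >=
   d(s, u s) + 16 delta], while the fixed point allows only [d(s, u s) + 2 delta]. *)
destruct (hyp q s us uus) as [Hy|Hy]; unfold gromov in *;
  rewrite (dist_sym _ m s), (dist_sym _ um s) in *; lra.
Qed.

(** Cyclic reduction. If [h m] is the last center, conjugating by the first letter merges that
    letter into the last one. The word gets shorter and [c] becomes [a^-1 c], which is still in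
    [Q]. *)
Lemma word_no_fixpoint n : forall w h c,
  (length w <= n)%nat -> nontriv_word sail w -> alternating (map fst w) -> H h ->
  gmul (wprod w) h <> gone -> Q c -> act (gmul (wprod w) h) c <> c.
Proof.
induction n as [|n IH]; intros w h c len Rw A Hh nu Qc.
{ destruct w; [|simpl in len; lia]. destruct (Q_out c Qc) as (Cc & nS & _).
  unfold wprod in *; simpl in *. rewrite gmul1l in *. now apply H_free. }
destruct w as [|[m a] w]; [apply IH; simpl; auto; lia|].
destruct (classic (alternating (m :: map fst w ++ [act h m]))) as [A'|nA].
{ now apply cyclically_reduced_no_fixpoint. }
destruct (nontriv_word_cons _ _ _ Rw) as (Mm & Ga & na & Rw').
pose proof (sail_C m Mm) as Cm.
assert (w = [] \/ w <> []) as [->|ne] by (destruct w; auto; right; easy).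
(* For a single letter, failure of cyclic reducedness means [h m = m], so [h] is trivial and a
   rotation about [m] remains. *)
- assert (hm : act h m = m).
  { apply NNPP; intros n'. apply nA. simpl. auto. }
  assert (h = gone) as ->.
  { apply NNPP; intros nh. now apply (H_free m h Cm); [apply Mm| | |]. }
  unfold wprod; simpl. rewrite !gmul1r.
  destruct (Q_out c Qc) as (Cc & _ & nM).
  apply (fair_free m); try easy. now intros ->.
- destruct (exists_last ne) as (w0 & [z b] & ->).
  apply Forall_app in Rw'. destruct Rw' as [Rw0 Rz].
  destruct (nontriv_word_cons _ _ _ Rz) as (Mz & Gb & nb & _).
  pose proof (sail_C z Mz) as Cz.
  change (alternating (m :: map fst (w0 ++ [(z, b)]))) in A.
  rewrite map_app in A, nA. change (map fst [(z, b)]) with [z] in A, nA.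
  assert (z = act h m) as ->.
  { apply NNPP; intros n'. apply nA. rewrite <- app_assoc.
    apply (alternating_glue (m :: map fst w0)); [exact A|]. simpl. auto. }
  set (b' := gmul b (gmul h (gmul a (ginv h)))).
  assert (Gb' : Gc (act h m) b').
  { apply Gc_mul; [easy..|]. now apply Gc_conj. }
  assert (A0 : alternating (map fst w0 ++ [act h m])).
  { exact (alternating_tail m _ A). }
  intros E.
  assert (E' : act (gmul (gmul (wprod w0) b') h) (act (ginv a) c)
               = act (ginv a) c).
  { rewrite <- E at 2. rewrite <- !actM. f_equal.
    change ((m, a) :: w0 ++ [(act h m, b)])
      with ([(m, a)] ++ w0 ++ [(act h m, b)]).
    rewrite !wprod_app. unfold wprod, b'; simpl. now gsimp. }
  assert (nu' : gmul (gmul (wprod w0) b') h <> gone).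
  { intros E1. apply nu.
    transitivity (gmul a (gmul (gmul (gmul (wprod w0) b') h) (ginv a)));
      [|rewrite E1; now gsimp].
    change ((m, a) :: w0 ++ [(act h m, b)])
      with ([(m, a)] ++ w0 ++ [(act h m, b)]).
    rewrite !wprod_app. unfold wprod, b'; simpl. now gsimp. }
  assert (Qc' : Q (act (ginv a) c)) by now apply (Q_actV m).
  simpl in len. rewrite length_app in len. simpl in len.
  destruct (classic (b' = gone)) as [E1|nb'].
  + rewrite E1, gmul1r in *. revert E'. apply IH; try easy; [lia|].
    exact (alternating_app_l _ _ A0).
  + assert (wE : wprod (w0 ++ [(act h m, b')]) = gmul (wprod w0) b').
    { rewrite wprod_app. unfold wprod; simpl. now gsimp. }
    rewrite <- wE in E', nu'. revert E'. apply IH; try easy.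
    * rewrite length_app; simpl; lia.
    * apply Forall_app. split; [easy|].
      constructor; [easy|constructor].
    * now rewrite map_app.
Qed.
End Outside.

(** * The enlarged set and its normal forms *)

Lemma X_inhabited : inhabited X.
Proof. destruct S_ne as [s _]. exact (inhabits s). Qed.

Definition rep (m : X) : X :=
  epsilon X_inhabited (fun y => exists h, H h /\ y = act h m).

Lemma rep_orbit m : exists h, H h /\ rep m = act h m.
Proof.
apply (epsilon_spec X_inhabited (fun y => exists h, H h /\ y = act h m)).
exists m, gone. rewrite act1. split; [apply gen_one|easy].
Qed.

(** The choice depends only on the orbit as a predicate, and extensionality identifies the
    predicates of [m] and [h m]. *)
Lemma rep_act h m : H h -> rep (act h m) = rep m.
Proof.
intros Hh. unfold rep. f_equal. apply functional_extensionality; intros y.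
apply propositional_extensionality; split; intros (k & Hk & ->).
- exists (gmul k h). rewrite actM. split; [now apply gen_mul|easy].
- exists (gmul k (ginv h)). rewrite actM, actK. split; [|easy].
  apply gen_mul; [easy|]. now apply (gen_inv T); [apply T_C|].
Qed.

Definition enlarged (x : X) : Prop := T x \/ (sail x /\ rep x = x).

Lemma enlarged_hub x : enlarged x -> hub x.
Proof. intros [Tx|[Mx _]]; [left; now apply orbit_self | now right]. Qed.

Lemma enlarged_C x : enlarged x -> C x.
Proof. intros Ex. now apply hub_C, enlarged_hub. Qed.

Lemma enlarged_rep m : sail m -> enlarged (rep m).
Proof.
intros Mm. destruct (rep_orbit m) as (h & Hh & E). right. split.
- rewrite E. now apply sail_act.
- rewrite E at 1. now apply rep_act.
Qed.

Lemma H_enlarged h : H h -> gen enlarged h.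
Proof. apply gen_mono. now left. Qed.

Lemma sail_orbit m : sail m -> orbit enlarged m.
Proof.
intros Mm. pose proof (enlarged_rep m Mm) as Em.
destruct (rep_orbit m) as (h & Hh & E). rewrite E in Em.
apply (orbit_actV enlarged h); [apply enlarged_C|now apply H_enlarged|].
now apply orbit_self.
Qed.

Definition outside (c : X) : Prop := C c /\ ~ orbit enlarged c.

Lemma outside_out c : outside c -> C c /\ ~ S c /\ ~ sail c.
Proof.
intros [Cc nO]. split; [easy|split]; intros K; apply nO.
- revert K. apply orbit_mono. now left.
- now apply sail_orbit.
Qed.

Lemma outside_gen u c : gen enlarged u -> outside c -> outside (act u c).
Proof.
intros Eu [Cc nO]. split; [now apply C_act|].
intros O. now apply nO, (orbit_actV enlarged u); [apply enlarged_C| |].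
Qed.

Lemma outside_act m a c : sail m -> Gc m a -> outside c -> outside (act a c).
Proof.
intros Mm Ga. apply outside_gen.
apply (orbit_Gc_gen enlarged m); [apply enlarged_C|now apply sail_orbit|easy].
Qed.

(** A new letter from [T] is conjugated through the word and absorbed into [h]. A new rotation about
    a sail is prepended, or merged with the first letter when the centers agree. *)
Lemma enlarged_normal_form u : gen enlarged u ->
  exists w h, nontriv_word sail w /\ alternating (map fst w) /\ H h /\
    u = gmul (wprod w) h.
Proof.
intros Eu.
induction Eu as [|t g u Et Gg _ (w & h & Rw & A & Hh & ->)].
{ exists [], gone. split; [constructor|split; [easy|split]].
  - apply gen_one.
  - now rewrite gmul1r. }
destruct Et as [Tt|[Mt _]].
{ assert (Hg : H g) by now apply (gen_letter T t).
  exists (conj_word g w), (gmul g h). rewrite wprod_conj.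
  split; [now apply nontriv_word_conj|split; [now apply alternating_conj|split]].
  - now apply gen_mul.
  - now gsimp. }
assert (cons_case : forall b v, b <> gone -> Gc t b -> nontriv_word sail v ->
  alternating (t :: map fst v) -> exists w' h', nontriv_word sail w' /\
    alternating (map fst w') /\ H h' /\
    gmul b (gmul (wprod v) h) = gmul (wprod w') h').
{ intros b v nb Gb Rv Av. exists ((t, b) :: v), h.
  split; [now constructor|split; [easy|split; [easy|]]].
  unfold wprod; simpl. now gsimp. }
destruct (classic (g = gone)) as [->|ng].
{ exists w, h. now rewrite gmul1l. }
destruct w as [|[m a] w]; [now apply cons_case|].
destruct (classic (t = m)) as [<-|n]; [|now apply cons_case].
destruct (nontriv_word_cons _ _ _ Rw) as (_ & Ga & na & Rw').
replace (gmul g (gmul (wprod ((t, a) :: w)) h))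
  with (gmul (gmul g a) (gmul (wprod w) h))
  by (unfold wprod; simpl; now gsimp).
destruct (classic (gmul g a = gone)) as [->|nga].
- exists w, h. rewrite gmul1l. split; [easy|split; [|easy]].
  exact (alternating_tail t _ A).
- apply cons_case; try easy. apply Gc_mul; try easy. now apply sail_C.
Qed.

Lemma orbit_normal_form q : orbit enlarged q ->
  exists w y, nontriv_word sail w /\ hub y /\ alternating (map fst w ++ [y]) /\
    q = act (wprod w) y.
Proof.
intros (u & t & Eu & Et & ->).
destruct (enlarged_normal_form u Eu) as (w & h & Rw & A & Hh & ->).
rewrite actM. assert (By : hub (act h t)).
{ now apply hub_act, enlarged_hub. }
revert By. generalize (act h t). intros y By.
assert (w = [] \/ w <> []) as [->|ne] by (destruct w; auto; right; easy).
{ now exists [], y. }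
destruct (exists_last ne) as (w0 & [z b] & ->).
rewrite map_app in A. simpl in A.
destruct (classic (z = y)) as [->|n].
- exists w0, y. apply Forall_app in Rw. destruct Rw as [Rw0 Rz].
  destruct (nontriv_word_cons _ _ _ Rz) as (Mz & Gb & _).
  split; [easy|split; [easy|split; [easy|]]].
  rewrite wprod_app, actM. f_equal. unfold wprod; simpl. rewrite gmul1r.
  now apply Gc_fix; [apply sail_C|].
- exists (w0 ++ [(z, b)]), y.
  split; [easy|split; [easy|split; [|easy]]].
  rewrite map_app, <- app_assoc. simpl. apply alternating_glue; simpl; auto.
Qed.

Lemma enlarged_convex c p q :
  C c -> ~ orbit enlarged c -> orbit enlarged p -> orbit enlarged q ->
  5 * delta <= gromov c p q.
Proof.
intros Cc nO (u & x & Eu & Ex & ->) Oq.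
assert (Vu : gen enlarged (ginv u)) by (apply gen_inv; [apply enlarged_C|easy]).
rewrite <- (gromov_act (ginv u)), actK.
assert (Qc : outside (act (ginv u) c)) by now apply outside_gen.
assert (Oq' : orbit enlarged (act (ginv u) q)) by now apply orbit_act.
revert Qc Oq'. generalize (act (ginv u) c) (act (ginv u) q).
clear c q Cc nO Oq Eu Vu u. intros c q Qc Oq.
apply enlarged_hub in Ex as Bx.
destruct (orbit_normal_form q Oq) as (w & y & Rw & By & A & ->).
(* [chain_far] applies with [p] equal to [x], since [(x | z)_x = 0] and [(x | x)_c = d(c, x)]. A
   first letter centered at [x] is removed beforehand by pulling back. *)
assert (main : forall c v, outside c -> nontriv_word sail v ->
  alternating (x :: map fst v ++ [y]) ->
  5 * delta <= gromov c x (act (wprod v) y)).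
{ clear c Qc. intros c v Qc Rv Av.
  apply (chain_far outside_out outside_act v x c x y); try easy.
  - rewrite gromov_base. lra.
  - rewrite gromov_xx.
    pose proof (hub_Q_far outside_out c x Qc Bx). lra. }
destruct w as [|[m a] w].
- unfold wprod; simpl. rewrite act1.
  destruct (outside_out c Qc) as (Cc & nS & nM).
  pose proof (hub_pair_far c x y Cc nS nM Bx By). lra.
- destruct (classic (x = m)) as [<-|n]; [|now apply main].
  destruct (nontriv_word_cons _ _ _ Rw) as (Mx & Ga & na & Rw').
  rewrite act_wprod_cons, gromov_actV, (Gc_fixV x a (sail_C x Mx) Ga).
  apply main; try easy.
  apply (outside_act x); [easy| |easy]. now apply Gc_inv; [apply sail_C|].
Qed.

(** Conjugating the letters of [T] to the right turns a reduced word over [enlarged] into a reduced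
    word over sails. The leading block [blk] is recorded because it determines the first sail
    center, which the next letter must avoid. *)
Lemma enlarged_word_split v :
  nontriv_word enlarged v -> alternating (map fst v) ->
  exists blk tail w h, v = blk ++ tail /\ nontriv_word T blk /\
    nontriv_word sail w /\ alternating (map fst w) /\ H h /\
    wprod v = gmul (wprod w) h /\
    match tail, w with
    | [], [] => True
    | p :: _, q :: _ => fst q = act (wprod blk) (fst p) /\
        sail (fst p) /\ rep (fst p) = fst p
    | _, _ => False
    end.
Proof.
induction v as [|[x g] v IH]; intros Rv A.
{ exists [], [], [], gone. repeat split; try constructor.
  unfold wprod; simpl. now rewrite gmul1l. }
inversion Rv as [|? ? (Ex & Gx & nx) Rv']; simpl in Ex, Gx, nx; subst.
destruct (IH Rv' (alternating_tail x _ A))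
  as (blk & tail & w & h & -> & Rb & Rw & Aw & Hh & E & K).
assert (gE : wprod ((x, g) :: blk ++ tail) = gmul g (gmul (wprod w) h)).
{ rewrite <- E. easy. }
destruct Ex as [Tx|[Mx rx]].
- exists ((x, g) :: blk), tail, (conj_word g w), (gmul g h).
  assert (Hg : H g) by now apply (gen_letter T x).
  split; [easy|split; [now constructor|split; [now apply nontriv_word_conj|]]].
  split; [now apply alternating_conj|split; [now apply gen_mul|split]].
  + rewrite gE, wprod_conj. now gsimp.
  + destruct tail, w; try easy. simpl. destruct K as (-> & K).
    split; [|easy]. unfold wprod; simpl. now rewrite actM.
- exists [], ((x, g) :: blk ++ tail), ((x, g) :: w), h.
  split; [easy|split; [constructor|split; [now constructor|]]].
  split; [|split; [easy|split]].
  + destruct w as [|q w]; [easy|]. split; [|easy]. simpl.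
    destruct tail as [|p tail]; [easy|]. destruct K as (Eq & Mp & rp).
    intros Exq. rewrite Eq in Exq.
    assert (Hb : H (wprod blk)).
    { apply word_gen. revert Rb. apply Forall_impl. tauto. }
    (* Points of one [H]-orbit share their representative, so equal centers force [x = fst p].
       Either the given word was not alternating, or a nontrivial reduced product in [H] fixes the
       sail [x]. *)
    assert (xp : x = fst p).
    { rewrite <- rx, <- rp, Exq. now apply rep_act. }
    destruct blk as [|b blk].
    * destruct A as [n _]. now apply n.
    * apply (H_free x (wprod (b :: blk))); try easy; try apply Mx.
      -- apply T_good; [easy..|].
         pose proof (alternating_tail x (map fst ((b :: blk) ++ p :: tail)) A) as A'.
         rewrite map_app in A'.
         exact (alternating_app_l _ _ A').
      -- rewrite xp at 1. now rewrite <- Exq.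
  + rewrite gE. unfold wprod; simpl. now gsimp.
  + simpl. unfold wprod; simpl. now rewrite act1.
Qed.

Lemma enlarged_good : good enlarged.
Proof.
split; [apply enlarged_C|split; [|split]].
- intros v ne Rv A E1.
  destruct (enlarged_word_split v Rv A)
    as (blk & tail & w & h & -> & Rb & Rw & Aw & Hh & E & K).
  destruct w as [|[m a] w].
  + destruct tail; [|easy]. rewrite app_nil_r in *.
    revert E1. now apply T_good.
  + destruct S_ne as [s Ss].
    assert (Shs : S (act h s)) by now apply orbit_act.
    (* If the product is trivial, the polygon from [s] with last vertex given by [h s] closes up,
       against [chain_end_dist]. *)
    assert (Es : act (wprod ((m, a) :: w)) (act h s) = s).
    { now rewrite <- actM, <- E, E1, act1. }
    assert (D : 34 * delta <= dist s (act (wprod ((m, a) :: w)) (act h s))).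
    { destruct (nontriv_word_cons _ _ _ Rw) as (Mm & _).
      apply chain_end_dist; [easy..|now left|now left|].
      split; [now apply S_neq_sail|].
      apply (alternating_rcons (map fst ((m, a) :: w))); [easy|].
      intros y Hy Ey. apply (S_neq_sail _ y Shs); [|easy].
      apply in_map_iff in Hy. destruct Hy as (p & <- & Hin).
      unfold nontriv_word in Rw. rewrite Forall_forall in Rw. now apply (Rw p). }
    rewrite Es, dist_xx in D. lra.
- intros c u Cc nO Eu nu.
  destruct (enlarged_normal_form u Eu) as (w & h & Rw & A & Hh & ->).
  now apply (word_no_fixpoint outside_out outside_act (length w)).
- apply enlarged_convex.
Qed.

End Windmill.

(** * Maximal good sets *)

(** A center nearly realizing the infimum [mu] is a sail. Its representative is new: if it were in
    [T], that center would lie in the orbit of [T]. *)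
Lemma good_enlarge (T : X -> Prop) :
  good T -> (exists s, orbit T s) -> (exists c, C c /\ ~ orbit T c) ->
  exists T', good T' /\ (forall x, T x -> T' x) /\ exists x, T' x /\ ~ T x.
Proof.
intros gT ne [c0 [Cc0 nO0]]. destruct ne as [s Os].
destruct (near_infimum (fun r => exists c x y, C c /\ ~ orbit T c /\
  orbit T x /\ orbit T y /\ r = gromov c x y) (5 * delta) (4 * delta))
  as (mu & mu_ge & mu_le & r & (c & x & y & Cc & nO & Ox & Oy & ->) & le).
- exists (gromov c0 s s), c0, s, s. auto.
- intros r (c & x & y & Cc & nO & Ox & Oy & ->). now apply gT.
- lra.
- assert (mu_le' : forall c x y, C c -> ~ orbit T c -> orbit T x -> orbit T y ->
    mu <= gromov c x y).
  { intros d p q Cd nOd Op Oq. apply mu_le. now exists d, p, q. }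
  assert (Mc : @sail T mu c) by (split; [easy|split; [easy|]]; now exists x, y).
  set (ne := ex_intro _ s Os : exists s, orbit T s).
  exists (@enlarged T mu ne). split; [now apply enlarged_good|split].
  + intros t Tt. now left.
  + pose proof (enlarged_rep gT ne c Mc) as Er.
    exists (rep ne c). split; [easy|]. intros Tr.
    destruct (rep_orbit ne c) as (h & Hh & E).
    apply nO, (orbit_actV T h); [apply gT|easy|]. rewrite <- E.
    now apply orbit_self.
Qed.

Lemma gen_singleton c g : C c -> gen (eq c) g -> Gc c g.
Proof.
intros Cc Tg. induction Tg as [|t a g <- Ga _ IH]; [now apply Gc_one|].
now apply Gc_mul.
Qed.

Lemma good_singleton c : C c -> good (eq c).
Proof.
intros Cc. assert (O : forall x, orbit (eq c) x -> c = x).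
{ intros x (h & t & Th & <- & ->). symmetry. apply Gc_fix; [easy|].
  now apply gen_singleton. }
assert (n : forall d, ~ orbit (eq c) d -> d <> c).
{ intros d nO ->. now apply nO, orbit_self. }
split; [now intros t <-|split; [|split]].
- intros [|[t a] [|[t' a'] w]] ne Rw A; [easy| |].
  + inversion_clear Rw as [|? ? (_ & _ & na) _]. unfold wprod; simpl in *.
    now rewrite gmul1r.
  + inversion_clear Rw as [|? ? (E & _) Rw'].
    inversion_clear Rw' as [|? ? (E' & _) _].
    destruct A as [nt _]. simpl in *. congruence.
- intros d h Cd nO Th nh. apply (fair_free c); auto. now apply gen_singleton.
- intros d x y Cd nO Ox Oy. apply O in Ox, Oy. subst x y.
  rewrite gromov_xx. pose proof (sep_delta d c Cd Cc (n d nO)). lra.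
Qed.

(** Each condition involves finitely many letters, hence a single member of the chain. *)
Lemma good_chain_union (F : (X -> Prop) -> Prop) :
  (forall T, F T -> good T) ->
  (forall T T', F T -> F T' ->
     (forall x, T x -> T' x) \/ (forall x, T' x -> T x)) ->
  good (fun x => exists2 T, F T & T x).
Proof.
intros Fgood Ftot. set (U := fun x => exists2 T, F T & T x).
assert (FU : forall T x, F T -> T x -> U x) by (intros T x; now exists T).
(* The case [g = gone] covers an empty chain, where no [T] is available. *)
assert (genU : forall g, gen U g -> g = gone \/ exists2 T, F T & gen T g).
{ intros g Ug. induction Ug as [|t a g [T FT Tt] Ga _ IH]; [now left|right].
  destruct IH as [->|[T' FT' Tg]].
  - exists T; [easy|]. rewrite gmul1r. now apply (gen_letter T t).
  - destruct (Ftot T T' FT FT') as [I|I].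
    + exists T'; [easy|]. apply (gen_cons T' t); auto.
    + exists T; [easy|]. apply (gen_cons T t); try easy. now apply (gen_mono T'). }
assert (orbU : forall x, orbit U x -> exists2 T, F T & orbit T x).
{ intros x (h & t & Uh & [T FT Tt] & ->).
  destruct (genU h Uh) as [->|[T' FT' Th]].
  - exists T; [easy|]. rewrite act1. now apply orbit_self.
  - destruct (Ftot T T' FT FT') as [I|I].
    + exists T'; [easy|]. exists h, t. auto.
    + exists T; [easy|]. exists h, t. split; [now apply (gen_mono T')|easy]. }
assert (orbFU : forall T x, F T -> orbit T x -> orbit U x).
{ intros T x FT. apply orbit_mono. intros t. now apply FU. }
split; [|split; [|split]].
- intros t [T FT Tt]. now apply (Fgood T FT).
- intros w ne Rw A.
  assert (exists2 T, F T & nontriv_word T w) as [T FT RT].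
  { clear A. induction Rw as [|[t a] w (Ut & Ga & na) Rw IH]; [easy|].
    simpl in Ut, Ga, na. destruct Ut as [T FT Tt].
    destruct w as [|p w].
    - exists T; [easy|]. constructor; [easy|constructor].
    - destruct IH as [T' FT' Rw']; [easy|].
      destruct (Ftot T T' FT FT') as [I|I].
      + exists T'; [easy|]. constructor; [simpl; auto|easy].
      + exists T; [easy|]. constructor; [easy|].
        revert Rw'. apply Forall_impl. intros q (Tq & Gq). auto. }
  now apply (Fgood T FT).
- intros c h Cc nO Uh nh. destruct (genU h Uh) as [->|[T FT Th]]; [easy|].
  apply (Fgood T FT); try easy. intros O. now apply nO, (orbFU T).
- intros c x y Cc nO Ox Oy.
  destruct (orbU x Ox) as [T FT Tx], (orbU y Oy) as [T' FT' Ty].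
  destruct (Ftot T T' FT FT') as [I|I].
  + apply (Fgood T' FT'); try easy.
    * intros O. now apply nO, (orbFU T').
    * now apply (orbit_mono T).
  + apply (Fgood T FT); try easy.
    * intros O. now apply nO, (orbFU T).
    * now apply (orbit_mono T').
Qed.

Lemma exists_good_full : exists T, good T /\ forall c, C c -> orbit T c.
Proof.
destruct (classical_sets.Zorn_bigcup (P := good)) as [T [gT max]].
{ intros F FP Ftot. exact (good_chain_union F FP Ftot). }
exists T. split; [easy|]. intros c Cc. apply NNPP; intros nO.
assert (step : exists T', good T' /\ (forall x, T x -> T' x) /\
  exists x, T' x /\ ~ T x).
(* A maximal set could be empty, which leaves nothing to enlarge from; a single center then extends
   it. *)
{ destruct (classic (exists s, orbit T s)) as [ne|e].
  - apply good_enlarge; eauto.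
  - exists (eq c). split; [now apply good_singleton|].
    assert (nT : forall x, ~ T x).
    { intros x Tx. apply e. exists x. now apply orbit_self. }
    split; [intros x Tx; now destruct (nT x)|]. exists c. auto. }
destruct step as (T' & gT' & sub & x & Tx' & nTx).
apply (max T'); [|easy]. split; [exact sub|]. intros sub'. now apply nTx, sub'.
Qed.

Lemma normal_closure_free_product : exists C' : X -> Prop,
  (forall c, C' c -> C c) /\
  free_product_of (normal_closure (fun g => exists c, C c /\ Gc c g)) C' Gc.
Proof.
destruct exists_good_full as (T & gT & full).
assert (TC : forall t, T t -> C t) by apply gT.
exists T. split; [easy|split; [|split]].
- intros t Tt. split; [apply rot; auto|].
  intros g Gg N _ sub. apply sub. eauto.
(* The group [gen T] is normal: a conjugate of a rotation about [t] is a rotation about [k t], a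
   center again in the orbit of [T]. *)
- intros g Ng. apply gen_word, Ng.
  + split; [now apply gen_subgroup|]. intros k h Th.
    induction Th as [|t a h Tt Ga _ IH].
    * gsimp. apply gen_one.
    * replace (gmul k (gmul (gmul a h) (ginv k)))
        with (gmul (gmul k (gmul a (ginv k))) (gmul k (gmul h (ginv k))))
        by now gsimp.
      apply gen_mul; [|easy].
      apply (orbit_Gc_gen T (act k t)); [easy|now apply full, C_act, TC|].
      apply Gc_conj; auto.
  + intros a (c & Cc & Ga). apply (orbit_Gc_gen T c); auto.
- intros w ne Rw A. now apply gT.
Qed.
End RotatingFamily.

Theorem theorem5p1 (G : Group) (X : MetricSpace) (act : G -> X -> X)
  (delta rho : R) (C : X -> Prop) (Gc : X -> G -> Prop) :
  isometric_action G X act ->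
  hyperbolic X delta ->
  1 <= delta ->
  rotating_family act C Gc ->
  separated rho C ->
  fairly_rotating act C Gc ->
  rho >= 2 * delta * log2 delta + 38 * delta ->
  exists C' : X -> Prop,
    (forall c, C' c -> C c) /\
    free_product_of (normal_closure (fun g => exists c, C c /\ Gc c g)) C' Gc.
Proof.
intros iso hyp delta_ge1 rot sep fair rho_ge.
(* With [delta >= 1] the logarithmic term is nonnegative, whence [38 * delta <= rho]. *)
assert (log_ge0 : 0 <= log2 delta).
{ unfold log2, Rdiv. apply Rmult_le_pos.
  - rewrite <- ln_1. destruct delta_ge1 as [lt|<-]; [|lra].
    left. apply ln_increasing; lra.
  - left. apply Rinv_0_lt_compat. rewrite <- ln_1. apply ln_increasing; lra. }
apply (normal_closure_free_product iso rot fair sep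
  (hyperbolic_four_point delta hyp) delta_ge1).
nra.
Qed.
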